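(* Let $f:\mathbb{R}^n\to\mathbb{R}$ be convex and $L$-smooth, $h:\mathbb{R}^n\to\mathbb{R}$ be convex and $L_h$-smooth, $F=f+h$, and $0<\delta\le\frac14$. Assume that for a given number of iterations $N\ge1$ the number $$\hat\delta=2\sqrt{\frac{(L_h+2L)\delta}{(1-\sqrt{2\delta})^2L}}$$ satisfies $\hat\delta\le\frac{C}{(N+1)^{3/2}}$ with some constant $C\in(0,1/4)$. Then after $N$ iterations of STM_IPS $$F(x^N)-F(x^* )\le\frac{3R_0^2}{2A_N}.$$
   Context: The problem is $\min_{x\in\mathbb{R}^n}F(x)$; $x^*$ is the minimizer of $F$ closest to the starting point $z^0=x^0$ (a minimizer is assumed to exist) and $R_0=\|x^*-z^0\|_2$. STM_IPS (Similar Triangles Method with Inexact Proximal Step): $\tilde x^0=z^0=x^0$, $\alpha_0=A_0=0$. For $k=0,\dots,N-1$: choose $\alpha_{k+1}>0$ with $A_k+\alpha_{k+1}=2L\alpha_{k+1}^2$, $A_{k+1}=A_k+\alpha_{k+1}$; $\tilde x^{k+1}=(A_kx^k+\alpha_{k+1}z^k)/A_{k+1}$; let $$g_{k+1}(z)=\frac12\|z^k-z\|_2^2+\alpha_{k+1}\left(f(\tilde x^{k+1})+\langle\nabla f(\tilde x^{k+1}),z-\tilde x^{k+1}\rangle+h(z)\right),\qquad\hat z^{k+1}=\mathrm{argmin}_{z\in\mathbb{R}^n}g_{k+1}(z),$$ and let $z^{k+1}$ be any point with $g_{k+1}(z^{k+1})-g_{k+1}(\hat z^{k+1})\le\delta\|z^k-\hat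 z^{k+1}\|_2^2$; $x^{k+1}=(A_kx^k+\alpha_{k+1}z^{k+1})/A_{k+1}$. *)

(* Defs.v *)
From HB Require Import structures.
From mathcomp Require Import all_boot all_order all_algebra.
From mathcomp Require Import all_classical all_reals all_analysis.
Import Order.TTheory GRing.Theory Num.Theory.
Import numFieldNormedType.Exports.

Set Implicit Arguments.
Unset Strict Implicit.
Unset Printing Implicit Defensive.

Local Open Scope classical_set_scope.
Local Open Scope ring_scope.

Definition dotp (R : realType) (n : nat) (u v : 'rV[R]_n) : R :=
  \sum_(i < n) u 0 i * v 0 i.

(* The library norm `|u| on 'rV[R]_n is the sup norm; it is only used here
   through the topology, in the notion of differentiability. *)
Definition l2norm (R : realType) (n : nat) (u : 'rV[R]_n) : R :=
  Num.sqrt (dotp u u).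

Definition gradient (R : realType) (n : nat) (f : 'rV[R]_n -> R)
    (x : 'rV[R]_n) : 'rV[R]_n :=
  \row_(i < n) 'D_(delta_mx 0 i) f x.

Definition smooth (R : realType) (n : nat) (L : R) (f : 'rV[R]_n -> R) : Prop :=
  (forall x, differentiable f x) /\
  (forall x y, l2norm (gradient f x - gradient f y) <= L * l2norm (x - y)).

Definition argmin (R : realType) (T : Type) (g : T -> R) : set T :=
  [set p | forall q, g p <= g q].

(* The objective g_{k+1}, with a = alpha_{k+1}, zk = z^k, xt = \tilde x^{k+1}. *)
Definition prox_objective (R : realType) (n : nat) (f h : 'rV[R]_n -> R)
    (a : R) (zk xt z : 'rV[R]_n) : R :=
  1 / 2 * l2norm (zk - z) ^+ 2
  + a * (f xt + dotp (gradient f xt) (z - xt) + h z).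

(* A run of N iterations from x0. The scheme is not deterministic, as
   z^{k+1} may be any point satisfying the inexactness criterion, so a run is
   a family of sequences subject to these constraints; zh is \hat z (its value
   at 0 is irrelevant), xt is \tilde x, and indices above N are unconstrained. *)
Record STM_IPS (R : realType) (n : nat) (f h : 'rV[R]_n -> R) (L delta : R)
    (N : nat) (x0 : 'rV[R]_n) (alpha A : nat -> R)
    (xt zh z x : nat -> 'rV[R]_n) : Prop := {
  stm_xt0 : xt 0%N = x0;
  stm_z0 : z 0%N = x0;
  stm_x0 : x 0%N = x0;
  stm_alpha0 : alpha 0%N = 0;
  stm_A0 : A 0%N = 0;
  stm_alpha_gt0 : forall k, (k < N)%N -> 0 < alpha k.+1;
  stm_alphaE : forall k, (k < N)%N ->
    A k + alpha k.+1 = 2 * L * alpha k.+1 ^+ 2;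
  stm_AE : forall k, (k < N)%N -> A k.+1 = A k + alpha k.+1;
  stm_xtE : forall k, (k < N)%N ->
    xt k.+1 = (A k.+1)^-1 *: (A k *: x k + alpha k.+1 *: z k);
  stm_zh : forall k, (k < N)%N ->
    argmin (prox_objective f h (alpha k.+1) (z k) (xt k.+1)) (zh k.+1);
  stm_z : forall k, (k < N)%N ->
    prox_objective f h (alpha k.+1) (z k) (xt k.+1) (z k.+1)
    - prox_objective f h (alpha k.+1) (z k) (xt k.+1) (zh k.+1)
    <= delta * l2norm (z k - zh k.+1) ^+ 2;
  stm_xE : forall k, (k < N)%N ->
    x k.+1 = (A k.+1)^-1 *: (A k *: x k + alpha k.+1 *: z k.+1)
}.

Definition delta_hat (R : realType) (L Lh delta : R) : R :=
  2 * Num.sqrt ((Lh + 2 * L) * delta / ((1 - Num.sqrt (2 * delta)) ^+ 2 * L)).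

(* Main.v *)
Require Import Defs.
From HB Require Import structures.
From mathcomp Require Import all_boot all_order all_algebra.
From mathcomp Require Import all_classical all_reals all_analysis.
From mathcomp Require Import ring lra.
Import Order.TTheory GRing.Theory Num.Theory.
Import numFieldNormedType.Exports.
Local Open Scope classical_set_scope.
Local Open Scope ring_scope.

Set Implicit Arguments.
Unset Strict Implicit.

(** The proof is the Lyapunov argument for accelerated gradient methods, made
robust to the inexact proximal step.  With [V k = A_k (F(x^k) - F(x^* )) +
|z^k - x^*|^2 / 2], an exact proximal step would give [V (k+1) <= V k], with a
surplus of [|z^{k+1} - z^k|^2 / 4] left over by the choice
[A_{k+1} = 2 L alpha_{k+1}^2].  For an inexact step the extra term is
[<r, z^{k+1} - x^*>], where [r] is the gradient of the proximal objective at
[z^{k+1}] (lemma [similar_triangles_step]).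

The inexactness criterion controls [r].  The objective is 1-strongly convex,
hence [z^{k+1}] is within a factor [sqrt (2 delta)] of its minimizer relative
to the step [z^k - \hat z^{k+1}], and it is [(1 + alpha Lh)]-smooth, hence
[|r|^2] is at most [2 (1 + alpha Lh)] times the optimality gap.  Together,
[|r|^2 <= e |z^{k+1} - z^k|^2] (lemma [inexact_prox_gradient]), where the bound
[2 L alpha_k <= k] (lemma [step_size_le]) makes [e] proportional to
[N \hat delta^2].  Young's inequality charges [<r, z^{k+1} - x^*>] to the
surplus and to [e |z^{k+1} - x^*|^2 <= 2 e V (k+1)], so that
[(1 - 2 e) V (k+1) <= V k].  The hypothesis on [\hat delta] makes [2 e N] at
most [1/32], so that the errors multiply [V 0 = R_0^2 / 2] by at most 3 over the
[N] iterations (lemma [discrete_gronwall]). *)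

(** * The Euclidean inner product *)

Lemma dotpC (R : realType) (n : nat) (u v : 'rV[R]_n) : dotp u v = dotp v u.
Proof. by apply: eq_bigr => i _; rewrite mulrC. Qed.

Lemma dotpDl (R : realType) (n : nat) (u v w : 'rV[R]_n) :
  dotp (u + v) w = dotp u w + dotp v w.
Proof. by rewrite -big_split; apply: eq_bigr => i _; rewrite mxE mulrDl. Qed.

Lemma dotpZl (R : realType) (n : nat) (a : R) (u w : 'rV[R]_n) :
  dotp (a *: u) w = a * dotp u w.
Proof. by rewrite /dotp mulr_sumr; apply: eq_bigr => i _; rewrite mxE mulrA. Qed.

Lemma dotpNl (R : realType) (n : nat) (u w : 'rV[R]_n) :
  dotp (- u) w = - dotp u w.
Proof. by rewrite -scaleN1r dotpZl mulN1r. Qed.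

Lemma dotpDr (R : realType) (n : nat) (u v w : 'rV[R]_n) :
  dotp w (u + v) = dotp w u + dotp w v.
Proof. by rewrite ![dotp w _]dotpC dotpDl. Qed.

Lemma dotpZr (R : realType) (n : nat) (a : R) (u w : 'rV[R]_n) :
  dotp w (a *: u) = a * dotp w u.
Proof. by rewrite ![dotp w _]dotpC dotpZl. Qed.

Lemma dotpNr (R : realType) (n : nat) (u w : 'rV[R]_n) :
  dotp w (- u) = - dotp w u.
Proof. by rewrite ![dotp w _]dotpC dotpNl. Qed.

Definition dotpE := (dotpDl, dotpDr, dotpZl, dotpZr, dotpNl, dotpNr).

Lemma dotp_ge0 (R : realType) (n : nat) (u : 'rV[R]_n) : 0 <= dotp u u.
Proof. by apply: sumr_ge0 => i _; rewrite -expr2 sqr_ge0. Qed.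

Lemma dotp_eq0 (R : realType) (n : nat) (u : 'rV[R]_n) : dotp u u = 0 -> u = 0.
Proof.
move=> /eqP; rewrite psumr_eq0 => [/allP u0|i _]; last by rewrite -expr2 sqr_ge0.
apply/rowP => i; have := u0 i (mem_index_enum i).
by rewrite /= mulf_eq0 orbb mxE => /eqP.
Qed.

Lemma l2norm_sqr (R : realType) (n : nat) (u : 'rV[R]_n) :
  l2norm u ^+ 2 = dotp u u.
Proof. by rewrite sqr_sqrtr // dotp_ge0. Qed.

(** Young's inequality in the form in which an error [u] that is small relative
to a budget [b] is absorbed by it. *)
Lemma dotp_young (R : realType) (n : nat) (e b : R) (u v : 'rV[R]_n) :
  0 < e -> dotp u u <= e * b -> dotp u v <= 1 / 4 * b + e * dotp v v.
Proof.
move=> e0 ub; have := dotp_ge0 (u - (2 * e) *: v).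
rewrite !dotpE (dotpC v u) => sq0.
by rewrite -(ler_pM2l e0); lra.
Qed.

(** Cauchy-Schwarz without square roots, when [|u| <= c |v|]. *)
Lemma dotp_le_scaled (R : realType) (n : nat) (c : R) (u v : 'rV[R]_n) :
  0 <= c -> dotp u u <= c ^+ 2 * dotp v v -> dotp u v <= c * dotp v v.
Proof.
rewrite le_eqVlt => /predU1P[<-|c0] uv.
  have u0 : u = 0.
    apply/dotp_eq0/le_anti; rewrite dotp_ge0 andbT.
    by move: uv; rewrite expr0n /= mul0r.
  by rewrite u0 -(scale0r 0) dotpZl !mul0r.
have c2 : 0 < c / 2 by lra.
have := dotp_young (u := u) v c2 (b := 2 * c * dotp v v).
have -> : c / 2 * (2 * c * dotp v v) = c ^+ 2 * dotp v v by field.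
by move=> /(_ uv); lra.
Qed.

(** * First-order bounds for convex and for smooth functions *)

Lemma derive_gradient (R : realType) (n : nat) (f : 'rV[R]_n -> R)
    (x v : 'rV[R]_n) :
  differentiable f x -> 'D_v f x = dotp (gradient f x) v.
Proof.
move=> df; rewrite deriveE // [in LHS](row_sum_delta v) linear_sum.
by apply: eq_bigr => i _; rewrite linearZ mxE deriveE // mulrC.
Qed.

Lemma is_derive_line (R : realType) (n : nat) (f : 'rV[R]_n -> R)
    (x v : 'rV[R]_n) (t : R) :
  differentiable f (x + t *: v) ->
  is_derive t 1 (fun s => f (x + s *: v)) (dotp (gradient f (x + t *: v)) v).
Proof.
move=> df; have Df := diff_derivable (v := v) df.
(* The difference quotients of the restriction to the line are literally those
   of the directional derivative. *)
have quotE : (fun h : R => h^-1 *: (((fun s => f (x + s *: v)) \o shift t) (h *: 1)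
      - f (x + t *: v)))
    = (fun h : R => h^-1 *: ((f \o shift (x + t *: v)) (h *: v) - f (x + t *: v))).
  apply/funext => h /=; congr (_ *: (f _ - _)).
  by rewrite scalerDl addrCA [_ *: 1]mulr1.
by split; [rewrite /derivable quotE | rewrite -derive_gradient // /derive quotE].
Qed.

Lemma convex_segment (R : realType) (n : nat) (f : 'rV[R]_n -> R)
    (x v : 'rV[R]_n) (t : R) :
  convex_function [set: 'rV[R]_n] f -> 0 <= t -> t <= 1 ->
  f (x + t *: v) <= f x + t * (f (x + v) - f x).
Proof.
move=> fconv t0 t1.
have := fconv (Itv01 t0 t1) (x + v) x (in_setT _) (in_setT _).
rewrite convRE /conv /= /unstable.onem.
set p := (X in f X <= _ -> _); have -> : p = x + t *: v.
  by rewrite /p /conv /= scalerDr scalerBl scale1r addrC addrA subrK.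
by move=> /le_trans; apply; rewrite /=; lra.
Qed.

(** By convexity every forward difference quotient along [y - x] is at most
[f y - f x], and so is their limit. *)
Lemma convex_above_tangent (R : realType) (n : nat) (f : 'rV[R]_n -> R)
    (x y : 'rV[R]_n) :
  convex_function [set: 'rV[R]_n] f -> differentiable f x ->
  f x + dotp (gradient f x) (y - x) <= f y.
Proof.
move=> fconv df; rewrite -derive_gradient // addrC -lerBrDr.
have Df := cvg_dnbhs_at_right (diff_derivable (v := y - x) df).
apply: (cvgr_to_le Df).
near=> t; have t0 : 0 < t by near: t; exact: nbhs_right_gt.
have t1 : t <= 1 by near: t; exact: nbhs_right_le.
rewrite /= -[_ *: _]/(_ * _) ler_pdivrMl // [t *: _ + x]addrC lerBlDl.
have /le_trans := convex_segment x (y - x) fconv (ltW t0) t1; apply.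
by rewrite [x + _]addrC subrK.
Unshelve. all: by end_near. Qed.

(** The gap between [f] and its quadratic model is nonincreasing along the
segment from [x] to [x + v]: its derivative at time [t] is
[<grad f (x + t v) - grad f x, v> - t L |v|^2 <= 0]. *)
Lemma smooth_le_quadratic (R : realType) (n : nat) (L : R) (f : 'rV[R]_n -> R)
    (x v : 'rV[R]_n) :
  0 <= L -> smooth L f ->
  f (x + v) <= f x + dotp (gradient f x) v + L / 2 * dotp v v.
Proof.
move=> L0 [df Lf].
pose c := dotp (gradient f x) v; pose d := L / 2 * dotp v v.
pose gap (t : R) := f (x + t *: v) - (t * c + t ^+ 2 * d).
have gap_deriv (t : R) : is_derive t 1 gap
    (dotp (gradient f (x + t *: v)) v - (c + 2 * t * d)).
  have Dline := is_derive_line (df (x + t *: v)).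
  have Dquad : is_derive t (1 : R) (fun s : R => s * c + s ^+ 2 * d) (c + 2 * t * d).
    by apply: is_derive_eq; rewrite /= -![_ *: _]/(_ * _); ring.
  exact: is_deriveB.
have gap_le0 (t : R) : t \in `]0, 1[ -> gap^`()%classic t <= 0.
  rewrite in_itv derive1E derive_val => /andP[t0 _].
  have Lt0 : 0 <= L * t by rewrite mulr_ge0 // ltW.
  suff : dotp (gradient f (x + t *: v) - gradient f x) v <= L * t * dotp v v.
    by rewrite !dotpE -/c /d; lra.
  apply: dotp_le_scaled => //; have := Lf (x + t *: v) x; rewrite addrAC subrr add0r.
  rewrite -ler_sqr ?nnegrE ?mulr_ge0 ?sqrtr_ge0 //.
  by rewrite exprMn !l2norm_sqr !dotpE; lra.
have gap_ex (t : R) : derivable gap t 1 by exact: ex_derive.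
have gap_cont : {within `[0, 1], continuous gap}.
  by apply: derivable_within_continuous => t _; exact: gap_ex.
have := ler0_derive1_le_cc (fun t _ => gap_ex t) gap_le0 gap_cont (x := 1) (y := 0).
rewrite !in_itv /= !lexx ler01 => /(_ isT isT isT).
by rewrite /gap scale1r scale0r addr0 -/c -/d; lra.
Qed.

(** * The inexact proximal step *)

Lemma le_of_shrunk_le (R : realFieldType) (D G : R) :
  0 <= G -> (forall t, 0 < t -> t <= 1 -> (1 - t) * D <= G) -> D <= G.
Proof.
move=> G0 DG; rewrite leNgt; apply/negP => GD.
have D0 : 0 < D by exact: le_lt_trans GD.
have t0 : 0 < (D - G) / (2 * D) by rewrite divr_gt0 ?mulr_gt0 // subr_gt0.
have t1 : (D - G) / (2 * D) <= 1 by rewrite ler_pdivrMr ?mulr_gt0 //; lra.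
have tD : (D - G) / (2 * D) * D = (D - G) / 2 by field; rewrite gt_eqF.
by have := DG _ t0 t1; rewrite mulrBl tD; lra.
Qed.

(** Quadratic growth of the 1-strongly convex proximal objective around its
minimizer.  Comparing the minimizer with [zh + t w] and dividing by [t] gives
the bound with the factor [1 - t], for every [t] in (0, 1]. *)
Lemma argmin_prox_gap (R : realType) (n : nat) (f h : 'rV[R]_n -> R) (a : R)
    (zk xt zh w : 'rV[R]_n) :
  convex_function [set: 'rV[R]_n] h -> 0 <= a ->
  argmin (prox_objective f h a zk xt) zh ->
  1 / 2 * dotp w w
    <= prox_objective f h a zk xt (zh + w) - prox_objective f h a zk xt zh.
Proof.
move=> hconv a0 zh_min; set g := prox_objective f h a zk xt in zh_min *.
have seg t : 0 <= t -> t <= 1 ->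
    g (zh + t *: w) <= g zh + t * (g (zh + w) - g zh)
                       - t * (1 - t) * (1 / 2 * dotp w w).
  move=> t0 t1; have := ler_wpM2l a0 (convex_segment zh w hconv t0 t1).
  rewrite /g /prox_objective !l2norm_sqr !opprD !addrA.
  by rewrite !dotpE !(dotpC w) (dotpC zh zk); nra.
apply: le_of_shrunk_le => [|t t0 t1]; first by rewrite subr_ge0.
rewrite -(ler_pM2l t0).
by have := le_trans (zh_min _) (seg t (ltW t0) t1); lra.
Qed.

(** The gradient at [z] of [prox_objective f h a zk xt]. *)
Definition prox_gradient (R : realType) (n : nat) (f h : 'rV[R]_n -> R) (a : R)
    (zk xt z : 'rV[R]_n) : 'rV[R]_n :=
  z - zk + a *: (gradient f xt + gradient h z).

(** A gradient step of length [1 / (1 + a Lh)] from [z] decreases the proximal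
objective by [|r|^2 / (2 (1 + a Lh))], and cannot go below the minimum. *)
Lemma prox_gradient_sqr_le (R : realType) (n : nat) (f h : 'rV[R]_n -> R)
    (a Lh : R) (zk xt zh z : 'rV[R]_n) :
  0 <= Lh -> smooth Lh h -> 0 <= a ->
  argmin (prox_objective f h a zk xt) zh ->
  dotp (prox_gradient f h a zk xt z) (prox_gradient f h a zk xt z)
    <= 2 * (1 + a * Lh)
         * (prox_objective f h a zk xt z - prox_objective f h a zk xt zh).
Proof.
move=> Lh0 hsm a0 zh_min; set g := prox_objective f h a zk xt in zh_min *.
set e := prox_gradient f h a zk xt z; set M := 1 + a * Lh.
have M0 : 0 < M by rewrite ltr_wpDr // mulr_ge0.
have quad w : g (z + w) <= g z + dotp e w + M / 2 * dotp w w.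
  have := ler_wpM2l a0 (smooth_le_quadratic z w Lh0 hsm).
  rewrite /M /g /e /prox_gradient /prox_objective !l2norm_sqr !opprD !addrA.
  by rewrite !dotpE !(dotpC w) (dotpC z zk); lra.
have := le_trans (zh_min _) (quad (- M^-1 *: e)).
rewrite !(dotpZr (- M^-1) e) (dotpZl (- M^-1) e).
have -> : M / 2 * (- M^-1 * (- M^-1 * dotp e e)) = M^-1 * dotp e e / 2.
  by field; rewrite gt_eqF.
move=> H; have {H} : M^-1 * dotp e e <= 2 * (g z - g zh) by lra.
by rewrite ler_pdivrMl // mulrCA mulrA.
Qed.

(** The reverse triangle inequality [|u - v| >= |u| - |v| >= (1 - s) |u|],
squared; it follows from [|s u - v|^2 >= 0]. *)
Lemma dotp_sub_ge (R : realType) (n : nat) (s : R) (u v : 'rV[R]_n) :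
  0 < s -> s <= 1 -> dotp v v <= s ^+ 2 * dotp u u ->
  (1 - s) ^+ 2 * dotp u u <= dotp (u - v) (u - v).
Proof.
move=> s0 s1 vu; have := dotp_ge0 (s *: u - v); rewrite !dotpE (dotpC v u).
move=> young; rewrite -(ler_pM2l s0).
by nra.
Qed.

(** The tolerance is relative to the step to the exact minimizer [zh], which is
not computed; since [z] is close to [zh], that step is comparable to the actual
step from [zk] to [z]. *)
Lemma inexact_prox_gradient (R : realType) (n : nat) (f h : 'rV[R]_n -> R)
    (a Lh delta : R) (zk xt zh z : 'rV[R]_n) :
  convex_function [set: 'rV[R]_n] h -> 0 <= Lh -> smooth Lh h -> 0 <= a ->
  0 < delta -> delta <= 1 / 2 ->
  argmin (prox_objective f h a zk xt) zh ->
  prox_objective f h a zk xt z - prox_objective f h a zk xt zh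
    <= delta * l2norm (zk - zh) ^+ 2 ->
  (1 - Num.sqrt (2 * delta)) ^+ 2
      * dotp (prox_gradient f h a zk xt z) (prox_gradient f h a zk xt z)
    <= 2 * (1 + a * Lh) * delta * dotp (z - zk) (z - zk).
Proof.
move=> hconv Lh0 hsm a0 d0 d1 zh_min; rewrite l2norm_sqr => inexact.
set s := Num.sqrt (2 * delta).
have s2 : s ^+ 2 = 2 * delta by rewrite sqr_sqrtr // mulr_ge0 // ltW.
have s0 : 0 < s by rewrite sqrtr_gt0 mulr_gt0.
have s1 : s <= 1 by rewrite -(@expr_le1 _ 2 s isT (ltW s0)) s2; lra.
have close : dotp (z - zh) (z - zh) <= s ^+ 2 * dotp (zk - zh) (zk - zh).
  have := argmin_prox_gap (z - zh) hconv a0 zh_min.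
  by rewrite [zh + _]addrC subrK s2; lra.
have far : (1 - s) ^+ 2 * dotp (zk - zh) (zk - zh) <= dotp (z - zk) (z - zk).
  have := dotp_sub_ge s0 s1 close.
  by rewrite opprB addrA subrK -(opprB z zk) !dotpE; lra.
have M0 : 0 <= 2 * (1 + a * Lh) by rewrite mulr_ge0 // addr_ge0 // mulr_ge0.
have grad := prox_gradient_sqr_le z Lh0 hsm a0 zh_min.
have := le_trans grad (ler_wpM2l M0 inexact).
move=> /(ler_wpM2l (sqr_ge0 (1 - s))) /le_trans; apply.
have := ler_wpM2l (mulr_ge0 M0 (ltW d0)) far.
by lra.
Qed.

(** * One step of the method *)

(** The points [x'] and [xt] are the same barycenter of [x] with [z'] and with
[z], so [x' - xt] is [a / (A + a)] times [z' - z], and [A + a = 2 L a^2] turns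
the quadratic error of smoothness into exactly [|z' - z|^2 / 4]. *)
Lemma similar_triangles_step (R : realType) (n : nat) (f h : 'rV[R]_n -> R)
    (L Lh a A : R) (x xt x' z z' y : 'rV[R]_n) :
  0 < L -> convex_function [set: 'rV[R]_n] f -> smooth L f ->
  convex_function [set: 'rV[R]_n] h -> smooth Lh h ->
  0 < a -> 0 <= A -> A + a = 2 * L * a ^+ 2 ->
  xt = (A + a)^-1 *: (A *: x + a *: z) ->
  x' = (A + a)^-1 *: (A *: x + a *: z') ->
  (A + a) * ((f \+ h) x' - (f \+ h) y) + 1 / 2 * dotp (z' - y) (z' - y)
    <= A * ((f \+ h) x - (f \+ h) y) + 1 / 2 * dotp (z - y) (z - y)
       - 1 / 4 * dotp (z' - z) (z' - z)
       + dotp (prox_gradient f h a z xt z') (z' - y).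
Proof.
move=> L0 fconv fsm hconv hsm a0 A0 AaE xtE x'E.
have Aa0 : 0 < A + a by rewrite ltr_wpDl.
have Aa_neq0 : A + a != 0 by rewrite gt_eqF.
set b := a / (A + a).
have b0 : 0 <= b by rewrite divr_ge0 ?ltW.
have b1 : b <= 1 by rewrite ler_pdivrMr // mul1r lerDr.
have Ab : (A + a) * b = a by rewrite /b mulrC divfK.
have x'xt : x' = xt + b *: (z' - z).
  by rewrite x'E xtE; apply/rowP => i; rewrite !mxE /b; field.
have x'x : x' = x + b *: (z' - x).
  by rewrite x'E; apply/rowP => i; rewrite !mxE /b; field.
have xt_bary g : (A + a) * dotp g xt = A * dotp g x + a * dotp g z.
  by rewrite xtE !dotpE mulrA divff // mul1r.
have LbE : (A + a) * (L / 2 * (b * b)) = 1 / 4.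
  by rewrite /b AaE; field; rewrite !gt_eqF.
have [fdiff _] := fsm; have [hdiff _] := hsm.
set g := gradient f xt; set gh := gradient h z'.
have f_descent : (A + a) * f x'
    <= (A + a) * f xt + a * dotp g (z' - z) + 1 / 4 * dotp (z' - z) (z' - z).
  have := ler_wpM2l (ltW Aa0) (smooth_le_quadratic xt (b *: (z' - z)) (ltW L0) fsm).
  rewrite -x'xt -/g (dotpZl b) !(dotpZr b) -LbE.
  have -> : a * dotp g (z' - z) = (A + a) * (b * dotp g (z' - z)).
    by rewrite mulrA Ab.
  by lra.
have f_x := ler_wpM2l A0 (convex_above_tangent x fconv (fdiff xt)).
have f_y := ler_wpM2l (ltW a0) (convex_above_tangent y fconv (fdiff xt)).
have h_avg : (A + a) * h x' <= A * h x + a * h z'.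
  have := ler_wpM2l (ltW Aa0) (convex_segment x (z' - x) hconv b0 b1).
  by rewrite -x'x [x + _]addrC subrK mulrDr mulrA Ab; lra.
have h_y := ler_wpM2l (ltW a0) (convex_above_tangent y hconv (hdiff z')).
move: f_descent f_x f_y h_avg h_y (xt_bary g).
rewrite -/g -/gh /prox_gradient -/g -/gh /= !dotpE.
by rewrite (dotpC z z') (dotpC y z') (dotpC y z); lra.
Qed.

(** * Accumulation of the errors *)

(** With [u = 2 L a] the step rule reads [u (u - 1) = 2 L A <= k^2], which rules
out [u > k + 1]. *)
Lemma step_size_le (R : realType) (L A a k : R) :
  0 < L -> 0 < a -> 0 <= k -> A + a = 2 * L * a ^+ 2 -> 2 * L * A <= k ^+ 2 ->
  2 * L * a <= k + 1 /\ 2 * L * (A + a) <= (k + 1) ^+ 2.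
Proof.
move=> L0 a0 k0 aE Ak; set u := 2 * L * a.
have u0 : 0 < u by rewrite !mulr_gt0.
have uE : u ^+ 2 = 2 * L * (A + a) by rewrite aE /u; ring.
have uk : u <= k + 1.
  rewrite leNgt; apply/negP => ku.
  have : u ^+ 2 <= k ^+ 2 + u by rewrite uE /u; lra.
  by nra.
by split=> //; rewrite -uE ler_sqr ?nnegrE; lra.
Qed.

(** The left-hand side without the cube is [\hat delta^2 / 4], and [1/64] is
[C^2 / 4] at [C = 1/4]. *)
Lemma delta_hat_sqr_le (R : realType) (L Lh delta C : R) (N : nat) :
  0 < L -> 0 <= Lh -> 0 < delta -> 0 < C -> C < 1 / 4 ->
  delta_hat L Lh delta <= C / (N + 1)%:R `^ (3 / 2) ->
  (Lh + 2 * L) * delta / ((1 - Num.sqrt (2 * delta)) ^+ 2 * L)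
    * (N%:R + 1) ^+ 3 <= 1 / 64.
Proof.
move=> L0 Lh0 d0 C0 C1; rewrite /delta_hat.
set kappa := (Lh + 2 * L) * delta / _; set p := _ `^ _ => dle.
have kappa0 : 0 <= kappa.
  apply: divr_ge0; first by rewrite mulr_ge0 ?(ltW d0) // addr_ge0 // mulr_ge0 // ltW.
  by rewrite mulr_ge0 ?sqr_ge0 ?ltW.
have p2 : p ^+ 2 = (N%:R + 1) ^+ 3.
  rewrite -powR_mulrn ?powR_ge0 // /p -powRrM natrD.
  have -> : 3 / 2 * 2%:R = 3%:R :> R by field.
  by rewrite powR_mulrn // addr_ge0.
have p0 : 0 < p by rewrite powR_gt0 // ltr0n addn1.
have : 2 * Num.sqrt kappa * p <= C by rewrite -ler_pdivlMr.
have sk0 : 0 <= Num.sqrt kappa by exact: sqrtr_ge0.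
have lhs0 : 0 <= 2 * Num.sqrt kappa * p by rewrite !mulr_ge0 // ltW.
have C0' := ltW C0.
rewrite -ler_sqr ?nnegrE // !exprMn sqr_sqrtr // p2 => H.
have : C ^+ 2 <= (1 / 4) ^+ 2 by rewrite ler_sqr ?nnegrE; lra.
by lra.
Qed.

(** By Bernoulli's inequality [(1 - q)^N >= 1 - q N], applied one factor at a
time. *)
Lemma discrete_gronwall (R : realFieldType) (q : R) (V : nat -> R) (N : nat) :
  0 <= q -> q * N%:R <= 1 -> (forall k, (k <= N)%N -> 0 <= V k) ->
  (forall k, (k < N)%N -> (1 - q) * V k.+1 <= V k) ->
  (1 - q * N%:R) * V N <= V 0%N.
Proof.
move=> q0 qN V0 step; suff : forall k, (k <= N)%N -> (1 - q * k%:R) * V k <= V 0%N.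
  by apply.
elim=> [_|k IH kN]; first by rewrite mulr0 subr0 mul1r.
apply: le_trans (IH (ltnW kN)).
have qk : 0 <= 1 - q * k%:R.
  by rewrite subr_ge0 (le_trans _ qN) // ler_wpM2l // ler_nat ltnW.
apply: le_trans (ler_wpM2l qk (step _ kN)).
rewrite mulrA ler_wpM2r ?V0 //.
by have := mulr_ge0 (mulr_ge0 q0 q0) (ler0n R k); rewrite -natr1; lra.
Qed.

Theorem theoremE4 (R : realType) (n : nat) (f h : 'rV[R]_n -> R)
  (L Lh delta C : R) (N : nat)
  (x0 xs : 'rV[R]_n) (alpha A : nat -> R) (xt zh z x : nat -> 'rV[R]_n)
  (L_gt0 : 0 < L) (Lh_ge0 : 0 <= Lh)
  (f_convex : convex_function [set: 'rV[R]_n] f) (f_smooth : smooth L f)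
  (h_convex : convex_function [set: 'rV[R]_n] h) (h_smooth : smooth Lh h)
  (delta_gt0 : 0 < delta) (delta_le : delta <= 1 / 4)
  (N_ge1 : (1 <= N)%N)
  (C_gt0 : 0 < C) (C_lt : C < 1 / 4)
  (delta_hat_le : delta_hat L Lh delta <= C / (N + 1)%:R `^ (3 / 2))
  (run : STM_IPS f h L delta N x0 alpha A xt zh z x)
  (xs_min : argmin (f \+ h) xs)
  (xs_closest : forall y, argmin (f \+ h) y ->
    l2norm (xs - x0) <= l2norm (y - x0)) :
  (f \+ h) (x N) - (f \+ h) xs <= 3 * l2norm (xs - z 0%N) ^+ 2 / (2 * A N).
Proof.
have N1 : 1 <= N%:R :> R by rewrite (ler_nat R 1).
set s := Num.sqrt (2 * delta).
have s_lt1 : s < 1 by rewrite -sqrtr1 ltr_sqrt //; lra.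
have s1_gt0 : 0 < (1 - s) ^+ 2 by rewrite exprn_gt0 // subr_gt0.
have := delta_hat_sqr_le L_gt0 Lh_ge0 delta_gt0 C_gt0 C_lt delta_hat_le.
rewrite -/s; set kappa := (Lh + 2 * L) * delta / _ => kappaN.
have kappaE : kappa * ((1 - s) ^+ 2 * L) = (Lh + 2 * L) * delta.
  by rewrite divfK // gt_eqF // mulr_gt0.
have kappa0 : 0 < kappa.
  have num0 : 0 < Lh + 2 * L by lra.
  by apply: divr_gt0; exact: mulr_gt0.
(* By 1 <= N, 2 (1 + alpha Lh) delta / (1 - s)^2 <= e whenever 2 L alpha <= N. *)
pose e := N%:R * kappa.
have e0 : 0 < e by rewrite mulr_gt0 // (lt_le_trans _ N1).
have eN : 2 * e * N%:R <= 1 / 32 by rewrite /e; nra.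
have steps k : (k <= N)%N -> 0 <= A k /\ 2 * L * A k <= k%:R ^+ 2.
  elim: k => [_|k IH kN]; first by rewrite (stm_A0 run) mulr0 expr0n.
  have [A0 AL] := IH (ltnW kN).
  have a0 := stm_alpha_gt0 run kN.
  rewrite (stm_AE run kN) -[k.+1%:R]natr1; split; first by rewrite addr_ge0 // ltW.
  by have [] := step_size_le L_gt0 a0 (ler0n _ k) (stm_alphaE run kN) AL.
pose V k := A k * ((f \+ h) (x k) - (f \+ h) xs) + 1 / 2 * dotp (z k - xs) (z k - xs).
have gap0 y : 0 <= (f \+ h) y - (f \+ h) xs by rewrite subr_ge0.
have V0 k : (k <= N)%N -> 0 <= V k.
  by move=> /steps[A0 _]; rewrite addr_ge0 // ?mulr_ge0 ?gap0 ?dotp_ge0.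
have V_step k : (k < N)%N -> (1 - 2 * e) * V k.+1 <= V k.
  move=> kN; have [A0 AL] := steps _ (ltnW kN); have [A'0 _] := steps _ kN.
  have a0 := stm_alpha_gt0 run kN; have aE := stm_alphaE run kN.
  have AE := stm_AE run kN.
  have := stm_xtE run kN; have := stm_xE run kN; rewrite AE => xE xtE.
  have := similar_triangles_step xs L_gt0 f_convex f_smooth h_convex h_smooth
    a0 A0 aE xtE xE.
  have d2 : delta <= 1 / 2 by lra.
  have := inexact_prox_gradient h_convex Lh_ge0 h_smooth (ltW a0) delta_gt0
    d2 (stm_zh run kN) (stm_z run kN).
  rewrite -/s -AE -[_ * _ + _]/(V k.+1) -[_ * _ + _ in X in _ <= X - _ + _]/(V k).
  set r := prox_gradient _ _ _ _ _ _; set d := z k.+1 - z k; set w := z k.+1 - xs.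
  move=> r_le V_le.
  have [aL _] := step_size_le L_gt0 a0 (ler0n _ k) aE AL.
  have kN' : k%:R + 1 <= N%:R :> R by rewrite natr1 ler_nat.
  have r_e : dotp r r <= e * dotp d d.
    rewrite -(ler_pM2l (mulr_gt0 L_gt0 s1_gt0)).
    have -> : L * (1 - s) ^+ 2 * (e * dotp d d)
        = N%:R * (kappa * ((1 - s) ^+ 2 * L)) * dotp d d by rewrite /e; ring.
    rewrite kappaE -mulrA.
    apply: le_trans (ler_wpM2l (ltW L_gt0) r_le) _.
    have dd0 : 0 <= delta * dotp d d by rewrite mulr_ge0 ?dotp_ge0 // ltW.
    have : L * (2 * (1 + alpha k.+1 * Lh)) <= N%:R * (Lh + 2 * L) by nra.
    by move=> /(ler_wpM2r dd0); lra.
  have young : dotp r w <= 1 / 4 * dotp d d + e * dotp w w.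
    exact: dotp_young.
  have gapA := mulr_ge0 A'0 (gap0 (x k.+1)).
  have : e * dotp w w <= 2 * e * V k.+1.
    by rewrite /V -/w; have := mulr_ge0 (ltW e0) gapA; lra.
  by lra.
have e20 : 0 <= 2 * e by rewrite mulr_ge0 // ltW.
have eN1 : 2 * e * N%:R <= 1 by lra.
have := discrete_gronwall e20 eN1 V0 V_step.
have -> : V 0%N = 1 / 2 * l2norm (xs - z 0%N) ^+ 2.
  by rewrite /V (stm_A0 run) mul0r add0r l2norm_sqr -opprB !(dotpNl, dotpNr) opprK.
have AN0 : 0 < A N.
  have kN : (N.-1 < N)%N by rewrite prednK.
  rewrite -(prednK N_ge1) (stm_AE run kN) ltr_wpDl ?(stm_alpha_gt0 run) //.
  by have [] := steps _ (ltnW kN).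
rewrite ler_pdivlMr ?mulr_gt0 // => VN.
have ANgap : A N * ((f \+ h) (x N) - (f \+ h) xs) <= V N.
  by rewrite /V lerDl mulr_ge0 ?dotp_ge0.
have VN0 := V0 N (leqnn N).
(* 1/2 is enough: it gives A_N (F(x^N) - F(xs)) <= V N <= 2 V 0. *)
have : (1 / 2) * V N <= (1 - 2 * e * N%:R) * V N by rewrite ler_wpM2r //; lra.
by lra.
Qed.
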